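(* Let $n,m_1,m_2\ge1$ be integers, $r>0$, $D\subseteq\mathbb{R}^{m_1}$ compact, $U\subseteq\mathbb{R}^{m_2}$ locally compact with $0\in U$, $W=D\times U$, and let $f:L^\infty([-r,0);\mathbb{R}^n)\times L^\infty([-r,0];D)\times L^\infty([-r,0];U)\to\mathbb{R}^n$ satisfy: (H1) there exist non-decreasing $a,M,N:\mathbb{R}_+\to\mathbb{R}_+$ such that for every $R>0$ and all $x,y\in L^\infty([-r,0);\mathbb{R}^n)$, $w=(d,u)\in L^\infty([-r,0];W)$ with $\|x\|,\|y\|,\|w\|\le R$: $|f(x,w)-f(y,w)|\le N(R)h\sup_{-h\le s<0}|x(s)-y(s)|+M(R)\sup_{-r\le s<-h}|x(s)-y(s)|$ for all $h\in(0,r)$, and $|f(x,w)|\le a(R)$; (H2) for every $\delta>0$, $x\in L^\infty([-r,\delta);\mathbb{R}^n)$, $w\in L^\infty([-r,\delta];W)$, the function equal to $x$ a.e. on $[-r,0)$ and to $t\mapsto f(x_t,w_t)$ a.e. on $[0,\delta)$ belongs to $L^\infty([-r,\delta);\mathbb{R}^n)$; (H3) there exists $b\in K_\infty$ with $|f(x,d,u)|\le b(\max(\|x\|,\sup_{-r\le s\le0}|u(s)|))$ for all $x,d,u$. Consider the system $x(t)=f(x_t,d_t,u_t)$. Then the following statements are equivalent: (a) The system is ISS from the input $u\in U$ uniformly in $d\in D$. (b) There exist $\sigma\in KL$ and a continuous non-decreasing function $\gamma:\mathbb{R}_+\to\mathbb{R}_+$ such that for every $x_0\in L^\infty([-r,0);\mathbb{R}^n)$,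 $d\in L^\infty([-r,+\infty);D)$, $u\in L^\infty_{loc}([-r,+\infty);U)$ there exists $x\in L^\infty_{loc}([-r,+\infty);\mathbb{R}^n)$ with $x(t)=f(x_t,d_t,u_t)$ for a.e. $t\ge0$, $x(t)=x_0(t)$ for a.e. $t\in[-r,0)$, and $\|x_t\|\le\sigma(\|x_0\|,t)+\sup_{0\le s\le t}\gamma(\|u_s\|)$ for all $t\ge0$. Furthermore, if $U=\{0\}$, then the following statement is equivalent to (a) and (b): (c) The system is Robustly Forward Complete, i.e., for every $T\ge0$ and $R\ge0$, $\sup\{\|x_t\|:t\in[0,T],\ \|x_0\|\le R,\ d\in L^\infty([-r,+\infty);D)\}<+\infty$, where $x$ denotes the solution with $x=x_0$ a.e. on $[-r,0)$ corresponding to $d$ (and $u\equiv0$); and the Uniform Robust Attractivity property holds, i.e., there exists a continuous non-decreasing $\gamma:\mathbb{R}_+\to\mathbb{R}_+$ such that for every $\varepsilon>0$ and $R\ge0$ there exists $\tau=\tau(\varepsilon,R)>0$ with $\sup\{\|x_t\|-\sup_{0\le s\le t}\gamma(\|u_s\|):t\ge\tau,\ \|x_0\|\le R,\ d\in L^\infty([-r,+\infty);D),\ u\in L^\infty_{loc}([-r,+\infty);U)\}<\varepsilon$.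
   Context: Notation: $\mathbb{R}_+=[0,\infty)$; $L^\infty$, $L^\infty_{loc}$ are spaces of (locally) essentially bounded measurable functions; $\|x\|$ is the essential supremum norm and $\sup_{a\le s<b}$ means essential supremum; $x_t(s)=x(t+s)$ for $s\in[-r,0)$, and $d_t,u_t$ are defined similarly on $[-r,0]$. $K_\infty$: continuous, strictly increasing, zero at zero, unbounded functions $\mathbb{R}_+\to\mathbb{R}_+$; $KL$: continuous $\sigma:\mathbb{R}_+\times\mathbb{R}_+\to\mathbb{R}_+$ with $\sigma(\cdot,t)$ of class $K$ (continuous, strictly increasing, zero at zero) for each $t$ and $\sigma(s,\cdot)$ non-increasing with limit $0$ for each $s$. A solution with initial condition $x_0$ and inputs $d,u$ on $[0,T)$ is $x\in L^\infty_{loc}([-r,T);\mathbb{R}^n)$ with $x=x_0$ a.e. on $[-r,0)$ and $x(t)=f(x_t,d_t,u_t)$ for a.e. $t\in[0,T)$; under (H1),(H2) there is a unique maximally defined one, called the solution. Definition (ISS). Assume that for every $x_0\in L^\infty([-r,0);\mathbb{R}^n)$, $d\in L^\infty([-r,+\infty);D)$, $u\in L^\infty_{loc}([-r,+\infty);U)$ the solution exists on $[0,+\infty)$. The system is ISS from the input $u$ uniformly in $d$ if there exists a continuous non-decreasing $\gamma:\mathbb{R}_+\to\mathbb{R}_+$ such that (with all suprema over $d\in L^\infty([-r,+\infty);D)$, $u\in L^\infty_{loc}([-r,+\infty);U)$): (Robust Lagrange Stability) for every $\varepsilon>0$, $\sup\{\|x_t\|-\sup_{0\le s\le t}\gamma(\|u_s\|):t\ge0,\|x_0\|\le\varepsilon\}<+\infty$;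 (Robust Lyapunov Stability) for every $\varepsilon>0$ there is $\delta>0$ with $\sup\{\|x_t\|-\sup_{0\le s\le t}\gamma(\|u_s\|):t\ge0,\|x_0\|\le\delta\}<\varepsilon$; (Uniform Robust Attractivity) for every $\varepsilon>0$, $R\ge0$ there is $\tau>0$ with $\sup\{\|x_t\|-\sup_{0\le s\le t}\gamma(\|u_s\|):t\ge\tau,\|x_0\|\le R\}<\varepsilon$. *)

(* Defs.v *)
From HB Require Import structures.
From mathcomp Require Import all_boot all_order all_algebra.
From mathcomp Require Import all_classical all_reals all_analysis.
Set Implicit Arguments. Unset Strict Implicit. Unset Printing Implicit Defensive.
Import Order.TTheory GRing.Theory Num.Theory.
Import numFieldNormedType.Exports.
Local Open Scope classical_set_scope.
Local Open Scope ring_scope.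

Section TDSDefs.
Context {R : realType}.

Definition vnorm {k : nat} (v : 'rV[R]_k) : R :=
  Num.sqrt (\sum_(i < k) (v ord0 i) ^+ 2).

Definition wnorm {k l : nat} (d : 'rV[R]_k) (u : 'rV[R]_l) : R :=
  Num.sqrt (vnorm d ^+ 2 + vnorm u ^+ 2).

Definition itv_co (a b : R) : set R := [set s | a <= s < b].
Definition itv_cc (a b : R) : set R := [set s | a <= s <= b].
Definition itv_ge (a : R) : set R := [set s | a <= s].

Definition ae_on (A : set R) (P : R -> Prop) : Prop :=
  (@lebesgue_measure R).-negligible (A `&` [set s | ~ P s]).

Definition esssup (A : set R) (g : R -> R) : \bar R :=
  ereal_inf [set M : \bar R | ae_on A (fun s => ((g s)%:E <= M)%E)].

Definition supn {k : nat} (A : set R) (x : R -> 'rV[R]_k) : R :=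
  fine (esssup A (fun s => vnorm (x s))).

(* x (a representative) belongs to L^oo(A; V) *)
Definition Linf {k : nat} (A : set R) (V : set 'rV[R]_k) (x : R -> 'rV[R]_k) : Prop :=
  [/\ forall i : 'I_k, measurable_fun A (fun s => x s ord0 i),
      (esssup A (fun s => vnorm (x s)) < +oo)%E &
      ae_on A (fun s => V (x s))].

Definition shift {X : Type} (x : R -> X) (t : R) : R -> X := fun s => x (t + s).

Definition loc_compact_set {k : nat} (U : set 'rV[R]_k) : Prop :=
  forall z, U z -> exists K : set 'rV[R]_k,
    [/\ compact K, K `<=` U &
        exists e : R, 0 < e /\ (ball z e `&` U) `<=` K].

Definition nonneg_on_Rplus (g : R -> R) := forall s, 0 <= s -> 0 <= g s.
Definition nondecr_on_Rplus (g : R -> R) := forall s t, 0 <= s -> s <= t -> g s <= g t.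
Definition cont_on_Rplus (g : R -> R) := {within [set s : R | 0 <= s], continuous g}.

Definition gain_fun (g : R -> R) :=
  [/\ nonneg_on_Rplus g, cont_on_Rplus g & nondecr_on_Rplus g].

Definition classK (g : R -> R) :=
  [/\ nonneg_on_Rplus g, cont_on_Rplus g, g 0 = 0 &
      forall s t, 0 <= s -> s < t -> g s < g t].

Definition classKinf (g : R -> R) :=
  classK g /\ (forall M : R, exists s, 0 <= s /\ M < g s).

Definition classKL (sigma : R -> R -> R) :=
  [/\ {within [set p : R * R | 0 <= p.1 /\ 0 <= p.2],
        continuous (fun p : R * R => sigma p.1 p.2)},
      (forall t, 0 <= t -> classK (fun s => sigma s t)),
      (forall s t1 t2, 0 <= s -> 0 <= t1 -> t1 <= t2 -> sigma s t2 <= sigma s t1) &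
      (forall s, 0 <= s -> sigma s t @[t --> +oo] --> 0)].

Section System.
Variables (n m1 m2 : nat) (r : R) (D : set 'rV[R]_m1) (U : set 'rV[R]_m2).
Variable f : (R -> 'rV[R]_n) -> (R -> 'rV[R]_m1) -> (R -> 'rV[R]_m2) -> 'rV[R]_n.

Definition X0sp (x0 : R -> 'rV[R]_n) := Linf (itv_co (- r) 0) setT x0.
Definition Dsp (d : R -> 'rV[R]_m1) := Linf (itv_ge (- r)) D d.
Definition Usp (u : R -> 'rV[R]_m2) := forall T : R, Linf (itv_cc (- r) T) U u.

Definition hnorm (x : R -> 'rV[R]_n) (t : R) : R := supn (itv_co (- r) 0) (shift x t).
Definition inorm {k} (u : R -> 'rV[R]_k) (t : R) : R := supn (itv_cc (- r) 0) (shift u t).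

Definition global_solution x0 d u (x : R -> 'rV[R]_n) : Prop :=
  [/\ forall T : R, Linf (itv_co (- r) T) setT x,
      ae_on (itv_co (- r) 0) (fun s => x s = x0 s) &
      ae_on (itv_ge 0) (fun t => x t = f (shift x t) (shift d t) (shift u t))].

Definition forward_complete : Prop :=
  forall x0 d u, X0sp x0 -> Dsp d -> Usp u -> exists x, global_solution x0 d u x.

Definition gain_sup (gamma : R -> R) (u : R -> 'rV[R]_m2) (t : R) : \bar R :=
  ereal_sup [set (gamma (inorm u s))%:E | s in itv_cc 0 t].

(* { ||x_t|| - sup_{0<=s<=t} gamma(||u_s||) : T t, ||x_0|| <= eps, d, u }
   where x ranges over the (unique) solution(s) *)
Definition dev_set (gamma : R -> R) (T : set R) (eps : R) : set (\bar R) :=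
  [set e | exists x0 d u x t,
     [/\ [/\ X0sp x0, Dsp d & Usp u], global_solution x0 d u x,
         T t, hnorm x0 0 <= eps &
         e = ((hnorm x t)%:E - gain_sup gamma u t)%E]].

Definition robust_lagrange (gamma : R -> R) : Prop :=
  forall eps, 0 < eps -> (ereal_sup (dev_set gamma (itv_ge 0) eps) < +oo)%E.

Definition robust_lyapunov (gamma : R -> R) : Prop :=
  forall eps, 0 < eps -> exists delta, 0 < delta /\
    (ereal_sup (dev_set gamma (itv_ge 0) delta) < eps%:E)%E.

Definition uniform_robust_attractivity (gamma : R -> R) : Prop :=
  forall eps Rr, 0 < eps -> 0 <= Rr -> exists tau, 0 < tau /\
    (ereal_sup (dev_set gamma (itv_ge tau) Rr) < eps%:E)%E.

Definition ISS : Prop :=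
  forward_complete /\
  exists gamma, [/\ gain_fun gamma, robust_lagrange gamma,
                    robust_lyapunov gamma & uniform_robust_attractivity gamma].

Definition KL_estimate : Prop :=
  exists sigma gamma, [/\ classKL sigma, gain_fun gamma &
    forall x0 d u, X0sp x0 -> Dsp d -> Usp u ->
      exists x, global_solution x0 d u x /\
        forall t, 0 <= t ->
          ((hnorm x t)%:E <= (sigma (hnorm x0 0) t)%:E + gain_sup gamma u t)%E].

Definition RFC : Prop :=
  forward_complete /\
  forall T Rr : R, 0 <= T -> 0 <= Rr ->
    (ereal_sup [set e | exists x0 d x t,
       [/\ [/\ X0sp x0, Dsp d & (hnorm x0 0 <= Rr)%R],
           global_solution x0 d (fun _ => 0%R) x, itv_cc 0 T t &
           e = (hnorm x t)%:E]] < +oo)%E.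

Definition RFC_URA : Prop :=
  RFC /\ exists gamma, gain_fun gamma /\ uniform_robust_attractivity gamma.

Definition f_welldef : Prop :=
  forall x x' d d' u u',
    X0sp x -> X0sp x' -> Linf (itv_cc (- r) 0) D d -> Linf (itv_cc (- r) 0) D d' ->
    Linf (itv_cc (- r) 0) U u -> Linf (itv_cc (- r) 0) U u' ->
    ae_on (itv_co (- r) 0) (fun s => x s = x' s) ->
    ae_on (itv_cc (- r) 0) (fun s => d s = d' s) ->
    ae_on (itv_cc (- r) 0) (fun s => u s = u' s) ->
    f x d u = f x' d' u'.

Definition H1 : Prop :=
  exists a M N : R -> R,
    [/\ nonneg_on_Rplus a /\ nondecr_on_Rplus a,
        nonneg_on_Rplus M /\ nondecr_on_Rplus M,
        nonneg_on_Rplus N /\ nondecr_on_Rplus N &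
    forall Rr, 0 < Rr -> forall x y d u,
      X0sp x -> X0sp y -> Linf (itv_cc (- r) 0) D d -> Linf (itv_cc (- r) 0) U u ->
      supn (itv_co (- r) 0) x <= Rr -> supn (itv_co (- r) 0) y <= Rr ->
      fine (esssup (itv_cc (- r) 0) (fun s => wnorm (d s) (u s))) <= Rr ->
      (forall h, 0 < h < r ->
         vnorm (f x d u - f y d u) <=
           N Rr * h * supn (itv_co (- h) 0) (fun s => x s - y s)
           + M Rr * supn (itv_co (- r) (- h)) (fun s => x s - y s))
      /\ vnorm (f x d u) <= a Rr].

Definition H2 : Prop :=
  forall delta, 0 < delta -> forall x d u,
    Linf (itv_co (- r) delta) setT x -> Linf (itv_cc (- r) delta) D d ->
    Linf (itv_cc (- r) delta) U u ->
    exists z, [/\ Linf (itv_co (- r) delta) setT z,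
                  ae_on (itv_co (- r) 0) (fun s => z s = x s) &
                  ae_on (itv_co 0 delta)
                    (fun t => z t = f (shift x t) (shift d t) (shift u t))].

Definition H3 : Prop :=
  exists b, classKinf b /\
    forall x d u, X0sp x -> Linf (itv_cc (- r) 0) D d -> Linf (itv_cc (- r) 0) U u ->
      vnorm (f x d u) <= b (Num.max (supn (itv_co (- r) 0) x) (supn (itv_cc (- r) 0) u)).

End System.
End TDSDefs.

(* Main.v *)
(** (a) => (b): put beta(s, t) = max(0, sup { ||x_t'|| - sup gamma(||u||) : t' >= t,
    ||x_0|| <= s }).  It is finite by Lagrange stability, monotone in both variables,
    small for small s by Lyapunov stability and tends to 0 in t by attractivity.  Such
    a beta is dominated both by kappa(s) alpha(s) and by kappa(s) phi(t), with kappa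
    continuous nondecreasing, alpha of class K and phi continuous decreasing to 0, hence
    by the KL function kappa(s) sqrt(alpha(s) phi(t)).  Continuous majorants of monotone
    functions come from the Lipschitz sup-convolution sup_s (p(s) - |t - s|).

    (b) => (a) needs uniqueness, and (c) => (a) needs Lyapunov stability on a bounded
    time interval.  Both follow from one estimate: if N h <= 1/2 in (H1), the essential
    supremum of |x - y| for two solutions grows at most by the factor 2 (M + 1) over a
    time step h.  Uniqueness is the case of equal initial data; for (c) => (a) compare
    with the zero solution, which (H3) provides when u = 0. *)

Require Import Defs.
From HB Require Import structures.
From mathcomp Require Import all_boot all_order all_algebra.
From mathcomp Require Import all_classical all_reals all_analysis.
From mathcomp Require Import measurable_realfun ring lra.
Set Implicit Arguments.
Unset Strict Implicit.
Unset Printing Implicit Defensive.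
Import Order.TTheory GRing.Theory Num.Theory.
Import numFieldNormedType.Exports.
Local Open Scope classical_set_scope.
Local Open Scope ring_scope.

(** * Almost everywhere properties and essential suprema *)

Lemma lebesgue_negligible_shift (R : realType) (c : R) (N : set R) :
  (@lebesgue_measure R).-negligible N ->
  (@lebesgue_measure R).-negligible [set s | N (c + s)].
Proof.
move=> [B [mB B0 NB]].
pose phi : measurableTypeR R -> measurableTypeR R := fun s => c + s.
have cphi : continuous (phi : R -> R).
  by move=> s; apply: cvgD; [exact: cvg_cst|exact: cvg_id].
have mphi : measurable_fun setT phi by exact: continuous_measurable_fun.
exists (phi @^-1` B); split.
- by rewrite -[X in measurable X]setTI; exact: mphi.
(* The pushforward of Lebesgue measure under the translation agrees with it on half-open intervals,
   so uniqueness of the measure makes them equal. *)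
- rewrite -B0; symmetry.
  apply: (lebesgue_measure_unique (mu := pushforward (@lebesgue_measure R) phi)) => //.
  move=> _ [[a b] _ <-] /=.
  rewrite /pushforward (_ : phi @^-1` _ = `]a - c, b - c]%classic); last first.
    by apply/seteqP; split => s /=; rewrite !in_itv/= /phi; lra.
  rewrite !lebesgue_measure_itv/= !lte_fin ltrD2r; case: ifP => // _.
  by rewrite -!EFinB; congr EFin; ring.
- by move=> s /NB.
Qed.

Section EssentialSupremum.
Context {R : realType}.
Implicit Types (A B C : set R) (P Q : R -> Prop) (g : R -> R).

Lemma ae_on_sub A B P Q : B `<=` A -> (forall s, B s -> P s -> Q s) ->
  ae_on A P -> ae_on B Q.
Proof.
move=> BA PQ; apply: negligibleS => s [Bs nQ]; split; first exact: BA.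
by move=> /(PQ _ Bs).
Qed.

Lemma ae_onW A P : (forall s, A s -> P s) -> ae_on A P.
Proof.
move=> AP; apply: negligibleS (negligible_set0 _) => s [As] /=.
by apply; exact: AP.
Qed.

Lemma ae_on_and A P Q : ae_on A P -> ae_on A Q -> ae_on A (fun s => P s /\ Q s).
Proof.
move=> nP nQ; apply: negligibleS (negligibleU nP nQ) => s [As /not_andP[]] nn.
  by left.
by right.
Qed.

Lemma ae_onU A B C P : C `<=` A `|` B -> ae_on A P -> ae_on B P -> ae_on C P.
Proof.
move=> CAB nA nB; apply: negligibleS (negligibleU nA nB) => s [/CAB[]] As nP.
  by left.
by right.
Qed.

Lemma ae_on_forall A (P : nat -> R -> Prop) : (forall k, ae_on A (P k)) ->
  ae_on A (fun s => forall k, P k s).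
Proof.
move=> nP; apply: negligibleS (negligible_bigcup nP) => s [As /existsNP[k nk]].
by exists k.
Qed.

Lemma ae_on_shift A B P (t : R) : (forall s, B s -> A (t + s)) ->
  ae_on A P -> ae_on B (fun s => P (t + s)).
Proof.
move=> BA /(lebesgue_negligible_shift t); apply: negligibleS => s [Bs nP].
by split => //=; exact: BA.
Qed.

(** The sign of [c] covers a null set [A]: there [esssup] is [-oo] and [fine] returns [0]. *)
Lemma fine_esssup_le A g (c : R) : 0 <= c -> ae_on A (fun s => g s <= c) ->
  fine (esssup A g) <= c.
Proof.
move=> c0 gc; have : (esssup A g <= c%:E)%E by exact: ereal_inf_lbound.
by case: (esssup A g).
Qed.

Lemma esssup_lty A g c : ae_on A (fun s => g s <= c) -> (esssup A g < +oo)%E.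
Proof.
by move=> gc; apply: (@le_lt_trans _ _ c%:E); rewrite ?ltry//; exact: ereal_inf_lbound.
Qed.

(** The infimum defining [esssup] is attained: the bounds exceeding it by [1 / (k + 1)] hold outside
    null sets, and countably many null sets have a null union. *)
Lemma ae_le_fine_esssup A g : (esssup A g < +oo)%E ->
  ae_on A (fun s => g s <= fine (esssup A g)).
Proof.
move=> glty.
have H k : ae_on A (fun s => g s <= fine (esssup A g) + k.+1%:R^-1).
  have : (esssup A g < (fine (esssup A g) + k.+1%:R^-1)%:E)%E.
    move: glty; case: (esssup A g) => [e _||]//=.
      by rewrite lte_fin ltrDl.
    by rewrite ltNyr.
  move=> /ereal_inf_lt[M gM Mlt]; apply: ae_on_sub gM => // s _ gsM.
  by rewrite -lee_fin (le_trans gsM)// ltW.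
apply: ae_on_sub (ae_on_forall H) => // s _ gs.
apply/ler_addgt0Pr => e e0.
have [k _ ke] := near_infty_natSinv_lt (PosNum e0).
by rewrite (le_trans (gs k))// lerD2l ltW// ke/=.
Qed.

(* [fine] sends the value [-oo], taken when [A] is null, to [0]. *)
Lemma fine_esssup_ge0 A g : (forall s, 0 <= g s) -> 0 <= fine (esssup A g).
Proof.
move=> g0; have [//|e0] := leP 0 (fine (esssup A g)).
have : (esssup A g < 0)%E.
  by move: e0; case: (esssup A g) => [e| |] //=; rewrite ?ltxx ?lte_fin.
move=> /ereal_inf_lt[M gM M0].
move: e0; suff -> : esssup A g = -oo%E by rewrite ltxx.
apply/eqP; rewrite -leeNy_eq; apply: ereal_inf_lbound => /=.
apply: ae_on_sub gM => // s _ gsM.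
by have := lt_le_trans M0 (le_trans (g0 s : (0 <= (g s)%:E)%E) gsM); rewrite ltxx.
Qed.

End EssentialSupremum.

(** * Euclidean norms of vectors *)

Section Vnorm.
Context {R : realType}.

Lemma vnorm_ge0 k (v : 'rV[R]_k) : 0 <= vnorm v.
Proof. exact: sqrtr_ge0. Qed.

Lemma vnorm_sqr k (v : 'rV[R]_k) : vnorm v ^+ 2 = \sum_(i < k) v ord0 i ^+ 2.
Proof. by rewrite sqr_sqrtr// sumr_ge0// => i _; exact: sqr_ge0. Qed.

Lemma vnorm0 k : vnorm (0 : 'rV[R]_k) = 0.
Proof.
apply/eqP; rewrite -sqrf_eq0 vnorm_sqr big1// => i _.
by rewrite mxE expr0n.
Qed.

Lemma vnorm_le0 k (v : 'rV[R]_k) : vnorm v <= 0 -> v = 0.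
Proof.
move=> v0; have : vnorm v ^+ 2 = 0.
  by rewrite (_ : vnorm v = 0) ?expr0n//; apply/le_anti; rewrite v0 vnorm_ge0.
rewrite vnorm_sqr => /eqP; rewrite psumr_eq0; last by move=> i _; exact: sqr_ge0.
move=> /allP vi; apply/rowP => i; rewrite mxE.
by have := vi i (mem_index_enum _); rewrite /= sqrf_eq0 => /eqP.
Qed.

(** Summing [(a - b)^2 <= 2 a^2 + 2 b^2] over the coordinates bounds the square of the left side by
    [4 c^2]. *)
Lemma vnormB_le k (v w : 'rV[R]_k) c : vnorm v <= c -> vnorm w <= c ->
  vnorm (v - w) <= 2 * c.
Proof.
move=> vc wc; have c0 : 0 <= c by rewrite (le_trans _ vc)// vnorm_ge0.
rewrite -(@ler_pXn2r _ 2)// ?nnegrE ?vnorm_ge0 ?mulr_ge0//.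
have : vnorm v ^+ 2 <= c ^+ 2 by rewrite ler_pXn2r// ?nnegrE// vnorm_ge0.
have : vnorm w ^+ 2 <= c ^+ 2 by rewrite ler_pXn2r// ?nnegrE// vnorm_ge0.
have : vnorm (v - w) ^+ 2 <= 2 * vnorm v ^+ 2 + 2 * vnorm w ^+ 2.
  rewrite !vnorm_sqr !mulr_sumr -big_split/=; apply: ler_sum => i _.
  rewrite !mxE -subr_ge0; set a := v _ _; set b := w _ _.
  rewrite (_ : _ - _ = (a + b) ^+ 2); last by ring.
  exact: sqr_ge0.
by rewrite exprMn; lra.
Qed.

Lemma wnorm_le k l (d : 'rV[R]_k) (u : 'rV[R]_l) c c' :
  vnorm d <= c -> vnorm u <= c' -> wnorm d u <= c + c'.
Proof.
move=> dc uc; have := vnorm_ge0 d; have := vnorm_ge0 u => u0 d0.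
rewrite -(@ler_pXn2r _ 2)// ?nnegrE ?sqrtr_ge0//; last by lra.
rewrite sqr_sqrtr; last by rewrite addr_ge0// sqr_ge0.
nra.
Qed.

Lemma compact_vnorm_bounded k (D : set 'rV[R]_k) : compact D ->
  exists c, 0 <= c /\ forall v, D v -> vnorm v <= c.
Proof.
move=> /compact_bounded[M [_ HM]].
(* Boundedness gives a max-norm bound for every number strictly above [M]; the Euclidean bound
   follows coordinate by coordinate. *)
have := HM (`|M| + 1) (ltr_pwDr ltr01 (ler_norm M)) => DM.
exists (Num.sqrt (\sum_(i < k) (`|M| + 1) ^+ 2)); split; first exact: sqrtr_ge0.
move=> v /DM /= vM; rewrite ler_wsqrtr// ler_sum// => i _.
rewrite -[X in X <= _]real_normK ?num_real// lerXn2r ?nnegrE ?addr_ge0//.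
apply: le_trans vM; rewrite [leRHS]mx_normrE.
exact: (le_bigmax _ (fun ij : 'I_1 * 'I_k => `|v ij.1 ij.2|) (ord0, i)).
Qed.

End Vnorm.

Section LinfSpaces.
Context {R : realType} {k : nat}.
Implicit Types (A B : set R) (V : set 'rV[R]_k) (x y : R -> 'rV[R]_k).

Lemma supn_ge0 A x : 0 <= supn A x.
Proof. by apply: fine_esssup_ge0 => s; exact: vnorm_ge0. Qed.

Lemma supn_le A x (c : R) : 0 <= c -> ae_on A (fun s => vnorm (x s) <= c) ->
  supn A x <= c.
Proof. exact: fine_esssup_le. Qed.

Lemma ae_le_supn A V x : Linf A V x ->
  ae_on A (fun s => vnorm (x s) <= supn A x).
Proof. by case=> _ xlty _; exact: ae_le_fine_esssup. Qed.

Lemma Linf_shift A B V x t : measurable A -> measurable B ->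
  (forall s, B s -> A (t + s)) -> Linf A V x -> Linf B V (Defs.shift x t).
Proof.
move=> mA mB BA Lx; have [mx xlty xV] := Lx; split.
- move=> i; have mt : measurable_fun B (fun s : R => t + s).
    apply: measurable_funTS; apply: continuous_measurable_fun => s.
    by apply: cvgD; [exact: cvg_cst|exact: cvg_id].
  apply: (measurable_comp mA _ (mx i) mt).
  by move=> _ [s Bs <-]; exact: BA.
- by apply: (@esssup_lty _ _ _ (supn A x)); exact: ae_on_shift (ae_le_supn Lx).
- exact: ae_on_shift xV.
Qed.

Lemma supn_ae_eq A V x y : Linf A V y -> ae_on A (fun s => x s = y s) ->
  supn A x <= supn A y.
Proof.
move=> /ae_le_supn yA xy; apply: supn_le; first exact: supn_ge0.
by apply: ae_on_sub (ae_on_and yA xy) => // s _ [? ->].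
Qed.

End LinfSpaces.

Section Intervals.
Context {R : realType}.

Lemma measurable_itv_co (a b : R) : measurable (itv_co a b).
Proof. by rewrite (_ : itv_co a b = `[a, b[%classic) //.
Qed.

Lemma measurable_itv_cc (a b : R) : measurable (itv_cc a b).
Proof. by rewrite (_ : itv_cc a b = `[a, b]%classic) //.
Qed.

Lemma measurable_itv_ge (a : R) : measurable (Defs.itv_ge a).
Proof.
rewrite (_ : Defs.itv_ge a = `[a, +oo[%classic) //.
by apply/seteqP; split => s /=; rewrite in_itv/= andbT.
Qed.

End Intervals.

(** * Continuous dependence on the initial state *)

(** The inequality of (H1) with [N h <= 1/2], for [e = |x - y|]. Arbitrary almost everywhere bounds
    [c1] (recent past) and [c2] (older past) stand in for the two suprema. *)
Definition delay_bound {R : realType} (e : R -> R) (r h M t : R) : Prop :=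
  forall c1 c2 : R, 0 <= c1 -> 0 <= c2 ->
  ae_on (itv_co (- h) 0) (fun s => e (t + s) <= c1) ->
  ae_on (itv_co (- r) (- h)) (fun s => e (t + s) <= c2) ->
  e t <= 2^-1 * c1 + M * c2.

(** The supremum [S] of [e] up to [t1] satisfies [S <= S / 2 + (M + 1) c], and the half is absorbed
    on the left. This requires [S] to be finite, which is the purpose of [E]. *)
Lemma delay_growth_step (R : realType) (e : R -> R) (r h T M E t0 t1 c : R) :
  (forall s, 0 <= e s) -> 0 < h -> h < r -> 0 <= M ->
  ae_on (itv_co (- r) T) (fun s => e s <= E) ->
  ae_on (itv_co 0 T) (delay_bound e r h M) ->
  0 <= t0 -> t1 <= t0 + h -> t1 <= T -> 0 <= c ->
  ae_on (itv_co (- r) t0) (fun s => e s <= c) ->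
  ae_on (itv_co (- r) t1) (fun s => e s <= 2 * (M + 1) * c).
Proof.
move=> e0 h0 hr M0 eE e_delay t00 t10 t1T c0 ec.
pose S := fine (esssup (itv_co (- r) t1) e).
have S0 : 0 <= S by exact: fine_esssup_ge0.
have eS : ae_on (itv_co (- r) t1) (fun s => e s <= S).
  apply: ae_le_fine_esssup; apply: (@esssup_lty _ _ _ E).
  by apply: ae_on_sub eE => // s /andP[? ?]; apply/andP; split => //; lra.
have Mc : 0 <= M * c by exact: mulr_ge0.
suff eS' : ae_on (itv_co (- r) t1) (fun s => e s <= 2^-1 * S + (M + 1) * c).
  have : S <= 2^-1 * S + (M + 1) * c.
    by apply: fine_esssup_le eS'; lra.
  by move=> SS; apply: ae_on_sub eS => // s _ es; lra.
apply: (@ae_onU _ (itv_co (- r) 0) (itv_co 0 t1)).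
- move=> s /andP[s1 s2]; have [s0|s0] := ltP s 0.
    by left; apply/andP.
  by right; apply/andP.
- apply: ae_on_sub ec; first by move=> s /andP[? ?]; apply/andP; split => //; lra.
  by move=> s _ ?; lra.
- apply: ae_on_sub e_delay.
    by move=> s /andP[? ?]; apply/andP; split => //; lra.
  move=> t /andP[t_ge0 tt1] /(_ S c S0 c0) et.
  have etS : ae_on (itv_co (- h) 0) (fun s => e (t + s) <= S).
    by apply: ae_on_shift eS => s /andP[? ?]; apply/andP; split; lra.
  (* The older part of the window ends at [t - h < t1 - h <= t0], where [c] is already a bound. *)
  have etc : ae_on (itv_co (- r) (- h)) (fun s => e (t + s) <= c).
    by apply: ae_on_shift ec => s /andP[? ?]; apply/andP; split; lra.
  by have := et etS etc; lra.
Qed.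

Lemma delay_growth (R : realType) (e : R -> R) (r h T M E c : R) k :
  (forall s, 0 <= e s) -> 0 < h -> h < r -> 0 <= T -> 0 <= M ->
  ae_on (itv_co (- r) T) (fun s => e s <= E) ->
  ae_on (itv_co 0 T) (delay_bound e r h M) -> T <= k%:R * h -> 0 <= c ->
  ae_on (itv_co (- r) 0) (fun s => e s <= c) ->
  ae_on (itv_co (- r) T) (fun s => e s <= (2 * (M + 1)) ^+ k * c).
Proof.
move=> e0 h0 hr T0 M0 eE e_delay Tk c0 ec.
suff H j (t1 : R) : t1 <= j%:R * h -> t1 <= T ->
  ae_on (itv_co (- r) t1) (fun s => e s <= (2 * (M + 1)) ^+ j * c) by exact: H.
elim: j t1 => [|j IH] t1 t1j t1T.
  apply: ae_on_sub ec.
    by move=> s /andP[? ?]; apply/andP; split => //; lra.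
  by move=> s _ ?; rewrite expr0 mul1r.
(* The previous grid point is cut at [T], so that the induction hypothesis applies to it. *)
pose t0 := Num.min (j%:R * h) T.
have jh : 0 <= j%:R * h by rewrite mulr_ge0 ?ler0n// ltW.
have t0_ge0 : 0 <= t0 by rewrite /t0 le_min jh.
have t10 : t1 <= t0 + h.
  move: t1j; rewrite -natr1 mulrDl mul1r /t0 => ?.
  by have [_|_] := leP (j%:R * h) T; lra.
rewrite exprS -mulrA.
apply: (delay_growth_step e0 h0 hr M0 eE e_delay t0_ge0 t10 t1T).
  by rewrite mulr_ge0// exprn_ge0//; lra.
by apply: IH; rewrite ge_min lexx ?orbT.
Qed.

(** * Solutions of the delay system *)

Definition satisfies {R : realType} {n m1 m2 : nat}
    (f : (R -> 'rV[R]_n) -> (R -> 'rV[R]_m1) -> (R -> 'rV[R]_m2) -> 'rV[R]_n)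
    (T : R) x d u : Prop :=
  ae_on (itv_co 0 T)
    (fun t => x t = f (Defs.shift x t) (Defs.shift d t) (Defs.shift u t)).

Section Dynamics.
Context {R : realType} {n m1 m2 : nat} {r : R}.
Context {D : set 'rV[R]_m1} {U : set 'rV[R]_m2}.
Context {f : (R -> 'rV[R]_n) -> (R -> 'rV[R]_m1) -> (R -> 'rV[R]_m2) -> 'rV[R]_n}.
Implicit Types (x y : R -> 'rV[R]_n) (d : R -> 'rV[R]_m1) (u : R -> 'rV[R]_m2).

Lemma shift_X0sp T x t : Linf (itv_co (- r) T) setT x -> 0 <= t -> t <= T ->
  X0sp r (Defs.shift x t).
Proof.
move=> Lx t0 tT; apply: Linf_shift Lx; try exact: measurable_itv_co.
by move=> s /andP[? ?]; apply/andP; split; lra.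
Qed.

Lemma Dsp_shift d t : Dsp r D d -> 0 <= t ->
  Linf (itv_cc (- r) 0) D (Defs.shift d t).
Proof.
move=> Ld t0; apply: Linf_shift Ld.
- exact: measurable_itv_ge.
- exact: measurable_itv_cc.
- by move=> s /andP[? ?]; rewrite /Defs.itv_ge/=; lra.
Qed.

Lemma Usp_shift u t : Usp r U u -> 0 <= t ->
  Linf (itv_cc (- r) 0) U (Defs.shift u t).
Proof.
move=> Lu t0; apply: Linf_shift (Lu t); try exact: measurable_itv_cc.
by move=> s /andP[? ?]; apply/andP; split; lra.
Qed.

(** The order of quantifiers matters: [G] depends on the bound [K] and the horizon [T] alone, so it
    is uniform over solutions and inputs. *)
Lemma continuous_dependence (K T : R) : 0 < r -> H1 r D U f -> 0 < K -> 0 <= T ->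
  exists G : R, 0 <= G /\ forall x y d u (c : R), 0 <= c ->
    Linf (itv_co (- r) T) setT x -> Linf (itv_co (- r) T) setT y ->
    Dsp r D d -> Usp r U u ->
    ae_on (itv_co (- r) T) (fun s => vnorm (x s) <= K) ->
    ae_on (itv_co (- r) T) (fun s => vnorm (y s) <= K) ->
    ae_on (itv_cc (- r) T) (fun s => wnorm (d s) (u s) <= K) ->
    satisfies f T x d u -> satisfies f T y d u ->
    ae_on (itv_co (- r) 0) (fun s => vnorm (x s - y s) <= c) ->
    ae_on (itv_co (- r) T) (fun s => vnorm (x s - y s) <= G * c).
Proof.
move=> r0 [a [M [N [_ [M0 _] [N0 _] Hf]]]] K0 T0.
have MK := M0 K (ltW K0); have NK := N0 K (ltW K0).
(* The first term gives [h < r], the second [N K * h <= 1/2]; the [+ 1] allows [N K = 0]. *)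
pose h := Num.min (r / 2) (2 * (N K + 1))^-1.
have h0 : 0 < h.
  by rewrite lt_min; apply/andP; split; [lra|rewrite invr_gt0; lra].
have hr : h < r by apply: (@le_lt_trans _ _ (r / 2)); [rewrite ge_min lexx|lra].
have Nh : N K * h <= 2^-1.
  have : (N K + 1) * h <= 2^-1.
    have hle : h <= (2 * (N K + 1))^-1 by rewrite ge_min lexx orbT.
    apply: (@le_trans _ _ ((N K + 1) * (2 * (N K + 1))^-1)).
      by rewrite ler_wpM2l//; lra.
    by rewrite invfM mulrCA divff ?mulr1// gt_eqF//; lra.
  by rewrite mulrDl mul1r; lra.
have [k Tk] : exists k : nat, T <= k%:R * h.
  exists (Num.bound (T / h)); rewrite -ler_pdivrMr//; apply/ltW.
  by apply: le_lt_trans (archi_boundP _); rewrite ?divr_ge0// ltW.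
exists ((2 * (M K + 1)) ^+ k); split; first by rewrite exprn_ge0//; lra.
move=> x y d u c c0 Lx Ly Ld Lu xK yK wK xS yS xyc.
apply: (@delay_growth _ _ _ h _ (M K) (2 * K)) => //.
- by move=> s; exact: vnorm_ge0.
- by apply: ae_on_sub (ae_on_and xK yK) => // s _ [? ?]; exact: vnormB_le.
apply: ae_on_sub (ae_on_and xS yS) => // t /andP[t0 tT] [xt yt] c1 c2 c10 c20 e1 e2.
have shT s : itv_co (- r) 0 s -> itv_co (- r) T (t + s).
  by move=> /andP[? ?]; apply/andP; split; lra.
have := Hf K K0 (Defs.shift x t) (Defs.shift y t) (Defs.shift d t) (Defs.shift u t).
case.
- exact: shift_X0sp Lx t0 (ltW tT).
- exact: shift_X0sp Ly t0 (ltW tT).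
- exact: Dsp_shift.
- exact: Usp_shift.
- by apply: supn_le (ltW K0) _; exact: ae_on_shift xK.
- by apply: supn_le (ltW K0) _; exact: ae_on_shift yK.
- apply: fine_esssup_le (ltW K0) _; apply: ae_on_shift wK => s /andP[? ?].
  by apply/andP; split; lra.
move=> /(_ h); rewrite h0 hr => /(_ isT) fxy _.
rewrite xt yt (le_trans fxy)// lerD//.
  apply: ler_pM => //; [by rewrite mulr_ge0// ltW|exact: supn_ge0|exact: supn_le].
by rewrite ler_wpM2l//; exact: supn_le.
Qed.

Lemma global_satisfies x0 d u x T : global_solution r f x0 d u x -> satisfies f T x d u.
Proof.
by case=> _ _; apply: ae_on_sub => // s /andP[].
Qed.

Lemma input_bound d u (T : R) : Dsp r D d -> Usp r U u ->
  exists K : R, 0 < K /\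
  ae_on (itv_cc (- r) T) (fun s => wnorm (d s) (u s) <= K).
Proof.
move=> /ae_le_supn Ld /(_ T)/ae_le_supn Lu.
exists (supn (Defs.itv_ge (- r)) d + supn (itv_cc (- r) T) u + 1); split.
  by rewrite ltr_wpDl// addr_ge0//; exact: supn_ge0.
have Ld' : ae_on (itv_cc (- r) T) (fun s => vnorm (d s) <= supn (Defs.itv_ge (- r)) d).
  by apply: ae_on_sub Ld => // s /andP[].
apply: ae_on_sub (ae_on_and Ld' Lu) => // s _ [ds us].
by apply: le_trans (wnorm_le ds us) _; rewrite lerDl.
Qed.

(** Continuous dependence with initial distance [c = 0], for a [K] that bounds both solutions and
    the inputs up to time [t]. *)
Lemma global_solution_unique x0 d u x y t : 0 < r -> H1 r D U f -> Dsp r D d -> Usp r U u ->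
  global_solution r f x0 d u x -> global_solution r f x0 d u y -> 0 <= t ->
  ae_on (itv_co (- r) t) (fun s => x s = y s).
Proof.
move=> r0 Hf Ld Lu Sx Sy t0; have [Lx ix _] := Sx; have [Ly iy _] := Sy.
have [K1 [K10 wK]] := input_bound t Ld Lu.
have := ae_le_supn (Lx t); have := ae_le_supn (Ly t).
have := supn_ge0 (itv_co (- r) t) x; have := supn_ge0 (itv_co (- r) t) y.
set Ky := supn _ y; set Kx := supn _ x => Ky0 Kx0 yK xK.
have K0 : 0 < K1 + Kx + Ky by lra.
have [G [_ HG]] := continuous_dependence r0 Hf K0 t0.
have := HG x y d u 0 (lexx _) (Lx t) (Ly t) Ld Lu.
rewrite mulr0 => H; apply: ae_on_sub (H _ _ _ _ _ _) => //.
- by move=> s _ /vnorm_le0/subr0_eq.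
- by apply: ae_on_sub xK => // s _ ?; lra.
- by apply: ae_on_sub yK => // s _ ?; lra.
- by apply: ae_on_sub wK => // s _ ?; lra.
- exact: global_satisfies Sx.
- exact: global_satisfies Sy.
- apply: ae_on_sub (ae_on_and ix iy) => // s _ [-> ->].
  by rewrite subrr vnorm0.
Qed.

Lemma hnorm_unique x0 d u x y t : 0 < r -> H1 r D U f -> Dsp r D d -> Usp r U u ->
  global_solution r f x0 d u x -> global_solution r f x0 d u y -> 0 <= t ->
  hnorm r x t <= hnorm r y t.
Proof.
move=> r0 Hf Ld Lu Sx Sy t0; have [Ly _ _] := Sy.
apply: (supn_ae_eq (V := setT)); first exact: shift_X0sp (Ly t) t0 (lexx _).
apply: ae_on_shift (global_solution_unique r0 Hf Ld Lu Sx Sy t0).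
by move=> s /andP[? ?]; apply/andP; split; lra.
Qed.

End Dynamics.

(** * Continuous majorants *)

Section LipschitzMajorant.
Context {R : realType}.
Implicit Types p g : R -> R.

Definition lip_values p (t : R) : set R :=
  [set z | exists s, 0 <= s /\ z = p s - `|t - s|].

(** For [p] bounded above on [[0, +oo)], this is the least 1-Lipschitz function on the line that
    majorises [p] there. *)
Definition lip_majorant p (t : R) : R := sup (lip_values p t).

Lemma lip_majorant_ge p (C t s : R) : (forall s, 0 <= s -> p s <= C) -> 0 <= s ->
  p s - `|t - s| <= lip_majorant p t.
Proof.
move=> pC s0; apply: ub_le_sup; last by exists s.
exists C => _ [s' [s'0 ->]]; have := pC _ s'0; have := normr_ge0 (t - s'); lra.
Qed.

Lemma lip_majorant_le p (c t : R) : (forall s, 0 <= s -> p s - `|t - s| <= c) ->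
  lip_majorant p t <= c.
Proof.
move=> pc; apply: ge_sup; first by exists (p 0 - `|t - 0|), 0.
by move=> _ [s [s0 ->]]; exact: pc.
Qed.

Lemma le_lip_majorant p (C t : R) : (forall s, 0 <= s -> p s <= C) -> 0 <= t ->
  p t <= lip_majorant p t.
Proof.
by move=> pC t0; have := lip_majorant_ge t pC t0; rewrite subrr normr0 subr0.
Qed.

Lemma lip_majorant_continuous p (C : R) : (forall s, 0 <= s -> p s <= C) ->
  continuous (lip_majorant p).
Proof.
move=> pC.
have lip a b : lip_majorant p a <= lip_majorant p b + `|a - b|.
  apply: lip_majorant_le => s s0; have := lip_majorant_ge b pC s0.
  have := ler_normD (b - a) (a - s); rewrite addrA subrK (distrC b a); lra.
move=> t; apply/cvgrPdist_lt => eps eps0; near=> t'.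
apply: (@le_lt_trans _ _ `|t - t'|).
  by rewrite ler_norml; have := lip t t'; have := lip t' t; rewrite (distrC t' t); lra.
near: t'; exact: (nbhsx_ballx t eps eps0).
Unshelve. all: by end_near. Qed.

(** A competitor [t' <= s] is closer to [s] than to [t]; for [t' > s], monotonicity gives
    [p t' <= p s]. *)
Lemma lip_majorant_nonincreasing p (C : R) : (forall s, 0 <= s -> p s <= C) ->
  (forall s t, 0 <= s -> s <= t -> p t <= p s) ->
  forall s t, 0 <= s -> s <= t -> lip_majorant p t <= lip_majorant p s.
Proof.
move=> pC pmono s t s0 st; apply: lip_majorant_le => t' t'0.
have [t's|st'] := leP t' s.
  have := lip_majorant_ge s pC t'0; rewrite !ger0_norm ?subr_ge0//; first lra.
  exact: le_trans st.
have := le_lip_majorant pC s0; have := pmono s t' s0 (ltW st').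
have := normr_ge0 (t - t'); lra.
Qed.

Lemma lip_majorant_nondecreasing p (C : R) : (forall s, 0 <= s -> p s <= C) ->
  (forall s t, 0 <= s -> s <= t -> p s <= p t) ->
  forall s t, 0 <= s -> s <= t -> lip_majorant p s <= lip_majorant p t.
Proof.
move=> pC pmono s t s0 st; apply: lip_majorant_le => t' t'0.
have [tt'|t't] := leP t t'.
  have := lip_majorant_ge t pC t'0.
  rewrite !ler0_norm ?subr_le0//; first lra.
  exact: le_trans tt'.
have := le_lip_majorant pC (le_trans s0 st); have := pmono t' t t'0 (ltW t't).
have := normr_ge0 (s - t'); lra.
Qed.

Lemma vanishing_majorant p :
  (forall s, 0 <= s -> 0 <= p s) ->
  (forall s t, 0 <= s -> s <= t -> p t <= p s) ->
  (forall eps, 0 < eps -> exists t, 0 <= t /\ p t <= eps) ->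
  exists phi : R -> R, [/\ continuous phi,
    forall t, 0 <= t -> p t <= phi t,
    forall s t, 0 <= s -> s <= t -> phi t <= phi s &
    phi t @[t --> +oo] --> (0 : R)].
Proof.
move=> p0 pmono pvan.
have pC s : 0 <= s -> p s <= p 0 by move=> s0; exact: pmono.
exists (lip_majorant p); split.
- exact: lip_majorant_continuous pC.
- by move=> t; exact: le_lip_majorant pC.
- exact: lip_majorant_nonincreasing pC pmono.
apply/cvgrPdist_le => eps eps0; have [tau [tau0 ptau]] := pvan _ eps0.
near=> t.
(* From this time on, competitors [s <= tau] contribute at most [p 0 - (t - tau) <= 0], and later
   ones at most [p tau <= eps]. *)
have t0 : tau + p 0 <= t by near: t; apply: nbhs_pinfty_ge; rewrite num_real.
have tge0 : 0 <= t by have := p0 0 (lexx _); lra.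
rewrite sub0r normrN ger0_norm; last first.
  exact: le_trans (p0 _ tge0) (le_lip_majorant pC tge0).
apply: lip_majorant_le => s s0; have [stau|taus] := leP s tau.
  have := pC _ s0; have := ler_norm (t - s); lra.
have := pmono _ _ tau0 (ltW taus); have := normr_ge0 (t - s); lra.
Unshelve. all: by end_near. Qed.

(* The reciprocal of a positive continuous minorant of the bounded function
   [1 / g]: [g] itself may be unbounded, so has no Lipschitz majorant. *)
Lemma nondecreasing_majorant g :
  (forall s, 0 <= s -> 1 <= g s) ->
  (forall s t, 0 <= s -> s <= t -> g s <= g t) ->
  exists kappa : R -> R, [/\ continuous kappa,
    forall s, 0 <= s -> g s <= kappa s &
    forall s t, 0 <= s -> s <= t -> kappa s <= kappa t].
Proof.
move=> g1 gmono; pose p s := - (g s)^-1.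
have g0 s : 0 <= s -> 0 < g s by move=> /g1; exact: lt_le_trans.
have pC s : 0 <= s -> p s <= 0 by move=> s0; rewrite oppr_le0 invr_ge0 ltW// g0.
have pmono s t : 0 <= s -> s <= t -> p s <= p t.
  move=> s0 st; rewrite lerN2 lef_pV2 ?posrE ?gmono ?g0//; lra.
(* The supremum stays below [p m < 0]: competitors [s <= m] by monotonicity, and those beyond [m]
   because they are at distance at least 1 from [t] while [-1 <= p m]. *)
have neg t : lip_majorant p t < 0.
  pose m := Num.max t 0 + 1.
  have m0 : 0 <= m by rewrite addr_ge0// le_max lexx orbT.
  have tm : t + 1 <= m by rewrite lerD2r le_max lexx.
  apply: (@le_lt_trans _ _ (p m)); last by rewrite oppr_lt0 invr_gt0 g0.
  apply: lip_majorant_le => s s0; have [sm|ms] := leP s m.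
    have := pmono _ _ s0 sm; have := normr_ge0 (t - s); lra.
  have : -1 <= p m by rewrite lerN2 invf_le1 ?g1 ?g0.
  have := pC _ s0; have := ler_norm (- (t - s)); rewrite normrN; lra.
exists (fun s => (- lip_majorant p s)^-1); split.
- move=> s; apply: cvgV; first by rewrite oppr_eq0 lt_eqF.
  by apply: cvgN; exact: lip_majorant_continuous pC _.
- move=> s s0; rewrite -[leLHS]invrK lef_pV2 ?posrE ?oppr_gt0 ?invr_gt0 ?g0//.
  have := le_lip_majorant pC s0; rewrite /p; lra.
- move=> s t s0 st; rewrite lef_pV2 ?posrE ?oppr_gt0// lerN2.
  exact: lip_majorant_nondecreasing pC pmono _ _ s0 st.
Qed.

(* The change of variable [s = 1 / t] reduces continuity at [0] to decay at [+oo]. *)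
Lemma classK_majorant g :
  (forall s, 0 <= s -> 0 <= g s <= 1) ->
  (forall s t, 0 <= s -> s <= t -> g s <= g t) ->
  (forall eps, 0 < eps -> exists s, 0 < s /\ g s <= eps) ->
  exists alpha : R -> R, [/\ classK alpha, continuous alpha &
    forall s, 0 <= s -> g s <= alpha s].
Proof.
move=> g01 gmono gvan.
(* The value [1] bounds [g], so [p] is nonincreasing across [0] as well. *)
pose p (t : R) : R := if t <= 0 then 1 else g t^-1.
have [|||phi [cphi pphi phimono phivan]] := @vanishing_majorant p.
- move=> s s0; rewrite /p; case: ifPn => // _.
  by have /andP[] := g01 s^-1 (ltac:(by rewrite invr_ge0)).
- move=> s t s0 st; rewrite /p; case: ifPn => [t0|].
    by rewrite (le_trans st t0).
  rewrite -ltNge => t0; case: ifPn => [_|].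
    by have /andP[] := g01 t^-1 (ltac:(by rewrite invr_ge0 ltW)).
  by rewrite -ltNge => s_gt0; apply: gmono; rewrite ?invr_ge0 ?(ltW t0)// lef_pV2 ?posrE.
- move=> eps /gvan[s [s0 gs]]; exists s^-1; rewrite invr_ge0 ltW//; split => //.
  by rewrite /p [_ <= 0]leNgt invr_gt0 s0/= invrK.
have phi0 (t : R) : 0 <= t -> 0 <= phi t.
  move=> t0; apply: le_trans (pphi _ t0); rewrite /p; case: ifPn => // _.
  by have /andP[] := g01 t^-1 (ltac:(by rewrite invr_ge0)).
(* The term [s] makes [alpha] strictly increasing; [phi] is only weakly monotone. *)
pose alpha (s : R) : R := if s <= 0 then 0 else phi s^-1 + s.
have alpha_continuous : continuous alpha.
  have cid (s : R) : x @[x --> s] --> s by exact: cvg_id.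
  suff H (s : R) : alpha x @[x --> s] --> alpha s by exact: H.
  have [s0|s0|->] := ltgtP s 0.
  - have cl : (0 : R) @[_ --> s] --> alpha s.
      by rewrite /alpha (ltW s0); exact: cvg_cst.
    apply: cvg_trans cl; apply: near_eq_cvg; near=> s'; rewrite /alpha ifT// ltW//.
    by near: s'; exact: lt_nbhsl.
  - have sV : x^-1 @[x --> s] --> s^-1 by apply: cvgV (cid s); rewrite gt_eqF.
    have cl : phi x^-1 + x @[x --> s] --> alpha s.
      rewrite /alpha leNgt s0/=; apply: cvgD (cid s).
      exact: (cvg_comp _ _ sV (cphi s^-1)).
    apply: cvg_trans cl; apply: near_eq_cvg; near=> s'.
    rewrite /alpha leNgt ifF//; apply/negbTE.
    by rewrite negbK; near: s'; exact: lt_nbhsr.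
  - apply/left_right_continuousP; split.
      have cl : (0 : R) @[_ --> (0 : R)^'-] --> alpha 0.
        by rewrite /alpha lexx; exact: cvg_cst.
      by apply: cvg_trans cl; apply: near_eq_cvg; near=> s'; rewrite /alpha ifT// ltW.
    have c0 : x @[x --> (0 : R)^'+] --> (0 : R) by exact: cvg_at_right_filter.
    have V0 : x^-1 @[x --> (0 : R)^'+] --> +oo.
      by apply/cvgrVy => //; exact: nbhs_right_gt.
    have cl : phi x^-1 + x @[x --> (0 : R)^'+] --> alpha 0.
      rewrite /alpha lexx -[X in _ --> X]addr0; apply: cvgD c0.
      exact: (cvg_comp _ _ V0 phivan).
    apply: cvg_trans cl; apply: near_eq_cvg; near=> s'.
    by rewrite /alpha leNgt ifF//; apply/negbTE; rewrite negbK.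
exists alpha; split => //.
- split.
  + move=> s s0; rewrite /alpha; case: ifPn => //; rewrite -ltNge => s_gt0.
    by rewrite addr_ge0// phi0// invr_ge0.
  + exact: continuous_subspaceT.
  + by rewrite /alpha lexx.
  + move=> s t s0 st; rewrite /alpha [t <= 0]leNgt (le_lt_trans s0 st)/=.
    have t0 := le_lt_trans s0 st.
    case: ifPn => [_|]; first by rewrite ltr_wpDl// phi0// invr_ge0 ltW.
    rewrite -ltNge => s_gt0; rewrite ler_ltD// phimono ?invr_ge0 ?(ltW t0)//.
    by rewrite lef_pV2 ?posrE// ltW.
- move=> s s0; rewrite /alpha; case: ifPn => [s_le0|].
    (* Here [alpha 0 = 0], so [g 0 <= 0] is required: it follows from monotonicity and the small
       values of [g] at positive points. *)
    have -> : s = 0 by apply/le_anti; rewrite s_le0.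
    apply/ler_addgt0Pr => e e0; have [s' [s'0 gs']] := gvan _ e0.
    by rewrite add0r (le_trans _ gs')// gmono// ltW.
  rewrite -ltNge => s_gt0; have := pphi s^-1; rewrite invr_ge0 => /(_ s0).
  by rewrite /p [_ <= 0]leNgt invr_gt0 s_gt0/= invrK; lra.
Unshelve. all: by end_near. Qed.

End LipschitzMajorant.

(** * Majorants of class KL *)

Section KLMajorant.
Context {R : realType}.
Implicit Types beta : R -> R -> R.

(* Normalising by [(1 + beta s 0) (1 + s)] makes the decay in [t] uniform in [s]:
   large [s] are controlled by [1 / (1 + s)], bounded [s] by monotonicity. *)
Lemma product_majorant beta :
  (forall s t, 0 <= s -> 0 <= t -> 0 <= beta s t) ->
  (forall s s' t, 0 <= s -> s <= s' -> 0 <= t -> beta s t <= beta s' t) ->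
  (forall s t t', 0 <= s -> 0 <= t -> t <= t' -> beta s t' <= beta s t) ->
  (forall eps s, 0 < eps -> 0 <= s -> exists t, 0 <= t /\ beta s t <= eps) ->
  exists psi : R -> R, [/\ forall t, 0 <= t -> 0 <= psi t,
    forall s t, 0 <= s -> s <= t -> psi t <= psi s,
    forall eps, 0 < eps -> exists t, 0 <= t /\ psi t <= eps &
    forall s t, 0 <= s -> 0 <= t -> beta s t <= (1 + beta s 0) * (1 + s) * psi t].
Proof.
move=> b0 bs bt bvan; pose g (s : R) : R := (1 + beta s 0) * (1 + s).
have gs (s : R) : 0 <= s -> 1 + s <= g s.
  by move=> s0; have := b0 s 0 s0 (lexx _) => ?; rewrite /g ler_peMl; lra.
have gb (s : R) : 0 <= s -> beta s 0 <= g s.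
  move=> s0; have := b0 s 0 s0 (lexx _) => ?.
  by apply: (@le_trans _ _ (1 + beta s 0)); [lra|rewrite /g ler_peMr; lra].
pose V (t : R) : set R := [set z | exists s, 0 <= s /\ z = beta s t / g s].
have V0 t : V t !=set0 by exists (beta 0 t / g 0), 0.
have Vub (t : R) : 0 <= t -> ubound (V t) 1.
  move=> t0 _ [s [s0 ->]]; have g0 := gs s s0.
  rewrite ler_pdivrMr ?mul1r; last lra.
  exact: le_trans (bt _ _ _ s0 (lexx _) t0) (gb _ s0).
have Vhub (t : R) : 0 <= t -> has_ubound (V t) by move=> /Vub ?; exists 1.
exists (fun t => sup (V t)); split.
- move=> t t0; apply: (@le_trans _ _ (beta 0 t / g 0)).
    by rewrite divr_ge0 ?b0//; have := gs 0 (lexx _); lra.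
  by apply: ub_le_sup; [exact: Vhub|exists 0].
- move=> s t s0 st; apply: ge_sup => // _ [s' [s'0 ->]].
  apply: (@le_trans _ _ (beta s' s / g s')); last first.
    by apply: ub_le_sup; [exact: Vhub|exists s'].
  by rewrite ler_wpM2r ?bt// invr_ge0; have := gs _ s'0; lra.
(* The threshold [1 / eps] separates the two regimes. Below it
   [beta s t <= beta (1 / eps) t <= eps]; above it [1 <= eps * (1 + s)], hence
   [beta s 0 <= eps * g s]. *)
- move=> eps eps0; have S0 : 0 <= eps^-1 by rewrite invr_ge0 ltW.
  have [t [t0 bSt]] := bvan eps _ eps0 S0; exists t; split => //.
  apply: ge_sup => // _ [s [s0 ->]]; have g0 := gs s s0.
  have b_ge0 := b0 _ _ s0 t0.
  rewrite ler_pdivrMr; last lra.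
  have [sS|Ss] := leP s eps^-1.
    have := bs _ _ _ s0 sS t0 => ?; apply: (@le_trans _ _ eps); first lra.
    by rewrite ler_peMr; lra.
  apply: le_trans (bt _ _ _ s0 (lexx _) t0) _.
  have b00 := b0 s 0 s0 (lexx _).
  have : 1 <= eps * (1 + s).
    apply: (@le_trans _ _ (eps * eps^-1)); first by rewrite divff// gt_eqF.
    by rewrite ler_pM2l//; lra.
  rewrite /g mulrCA => ?; apply: (@le_trans _ _ (1 + beta s 0)); first lra.
  by rewrite ler_peMr; lra.
- move=> s t s0 t0; have g0 := gs s s0; rewrite -/(g s) -ler_pdivrMl; last lra.
  by rewrite mulrC; apply: ub_le_sup; [exact: Vhub|exists s].
Qed.

Lemma KL_majorant beta :
  (forall s t, 0 <= s -> 0 <= t -> 0 <= beta s t) ->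
  (forall s s' t, 0 <= s -> s <= s' -> 0 <= t -> beta s t <= beta s' t) ->
  (forall s t t', 0 <= s -> 0 <= t -> t <= t' -> beta s t' <= beta s t) ->
  (forall eps, 0 < eps -> exists s, 0 < s /\ beta s 0 <= eps) ->
  (forall eps s, 0 < eps -> 0 <= s -> exists t, 0 <= t /\ beta s t <= eps) ->
  exists sigma, classKL sigma /\
    forall s t, 0 <= s -> 0 <= t -> beta s t <= sigma s t.
Proof.
move=> b0 bs bt b0van bvan.
have [psi [psi0 psimono psivan bpsi]] := product_majorant b0 bs bt bvan.
have bz (s : R) : 0 <= s -> 0 <= beta s 0 by move=> s0; exact: b0.
have bzmono (s s' : R) : 0 <= s -> s <= s' -> beta s 0 <= beta s' 0.
  by move=> s0 ss'; exact: bs.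
have g1 (s : R) : 0 <= s -> 1 <= (1 + beta s 0) * (1 + s).
  by move=> s0; have := bz _ s0 => ?; rewrite -[leLHS]mul1r ler_pM//; lra.
have [|kappa [ckappa gkappa kappamono]] := nondecreasing_majorant g1.
  move=> s t s0 st; have := bzmono _ _ s0 st; have := bz _ s0 => ? ?.
  by rewrite ler_pM//; lra.
have kappa1 (s : R) : 0 <= s -> 1 <= kappa s.
  by move=> s0; exact: le_trans (g1 _ s0) (gkappa _ s0).
(* The truncation at [1] gives the bounded function that [classK_majorant] expects; where
   [beta s 0 >= 1], the factor [kappa s >= 1 + beta s 0] makes up for it. *)
have [|||alpha [Kalpha calpha balpha]] :=
    @classK_majorant R (fun s => Num.min 1 (beta s 0)).
- by move=> s s0; rewrite le_min ler01 bz//= ge_min lexx.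
- by move=> s t s0 st; rewrite le_min !ge_min lexx/= bzmono// orbT.
- move=> eps /b0van[s [s0 be]]; exists s; split => //.
  by rewrite ge_min be orbT.
have inv0 (t : R) : 0 <= t -> 0 < (1 + t)^-1 by move=> ?; rewrite invr_gt0; lra.
(* Since [psi] may vanish, [1 / (1 + t)] is added to keep [phi] positive; otherwise [sigma] would
   not be strictly increasing in [s]. *)
have [|||phi [cphi pphi phimono phivan]] :=
    @vanishing_majorant R (fun t => psi t + (1 + t)^-1).
- by move=> t t0; rewrite addr_ge0 ?psi0// ltW ?inv0.
- by move=> s t s0 st; rewrite lerD ?psimono// lef_pV2 ?posrE//; lra.
- move=> eps eps0; have e20 : 0 < eps / 2 by lra.
  have [t [t0 pt]] := psivan _ e20; pose t' := Num.max t (eps / 2)^-1.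
  have tt' : t <= t' by rewrite le_max lexx.
  have et' : (eps / 2)^-1 <= t' by rewrite le_max lexx orbT.
  exists t'; split; first exact: le_trans tt'.
  have := psimono _ _ t0 tt'.
  have : (1 + t')^-1 <= eps / 2.
    by rewrite -[leRHS]invrK lef_pV2 ?posrE ?invr_gt0//; lra.
  lra.
have phi0 (t : R) : 0 <= t -> 0 < phi t.
  move=> t0; apply: lt_le_trans (pphi _ t0); have := psi0 _ t0.
  by have := inv0 _ t0; lra.
have [alpha0 calpha' alphaz alphamono] := Kalpha.
pose A (s : R) := kappa s * Num.sqrt (alpha s).
have cA : continuous A.
  move=> s; apply: cvgM; first exact: ckappa.
  exact: (cvg_comp _ _ (calpha s) (@sqrt_continuous _ _)).
have cB : continuous (fun t => Num.sqrt (phi t)).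
  by move=> t; exact: (cvg_comp _ _ (cphi t) (@sqrt_continuous _ _)).
have A0 (s : R) : 0 <= s -> 0 <= A s.
  by move=> s0; rewrite mulr_ge0 ?sqrtr_ge0// (le_trans ler01)// kappa1.
exists (fun s t => A s * Num.sqrt (phi t)); split; first split.
- apply: continuous_subspaceT => -[s t]; apply: cvgM.
    exact: (cvg_comp (fun p : R * R => p.1) A cvg_fst (cA s)).
  exact: (cvg_comp (fun p : R * R => p.2) (fun t => Num.sqrt (phi t)) cvg_snd (cB t)).
- move=> t t0; split.
  + by move=> s s0; rewrite mulr_ge0 ?A0// sqrtr_ge0.
  + by apply: continuous_subspaceT => s; apply: cvgM; [exact: cA|exact: cvg_cst].
  + by rewrite /A alphaz sqrtr0 mulr0 mul0r.
  + move=> s s' s0 ss'; rewrite ltr_pM2r ?sqrtr_gt0 ?phi0//.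
    have alphas' : 0 < alpha s'.
      by apply: le_lt_trans (alphamono _ _ s0 ss'); exact: alpha0.
    apply: (@le_lt_trans _ _ (kappa s' * Num.sqrt (alpha s))).
      by rewrite ler_wpM2r ?sqrtr_ge0// kappamono// ltW.
    rewrite ltr_pM2l ?ltr_sqrt ?alphamono//.
    by apply: lt_le_trans (kappa1 _ _); lra.
- move=> s t t' s0 t0 tt'; rewrite ler_wpM2l ?A0//.
  by rewrite ler_wsqrtr// phimono.
- move=> s s0; rewrite -[X in _ --> X](mulr0 (A s)); apply: cvgM.
    exact: cvg_cst.
  rewrite -[X in _ --> X](@sqrtr0 R).
  exact: (cvg_comp _ _ phivan (@sqrt_continuous _ _)).
move=> s t s0 t0.
have k0 : 0 <= kappa s by rewrite (le_trans ler01)// kappa1.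
have b_ak : beta s t <= alpha s * kappa s.
  apply: (le_trans (bt _ _ _ s0 (lexx _) t0)).
  apply: (@le_trans _ _ (Num.min 1 (beta s 0) * kappa s)); last first.
    by rewrite ler_wpM2r// balpha.
  have [_|_] := leP 1 (beta s 0).
    rewrite mul1r; apply: le_trans (gkappa _ s0); have := bz _ s0 => ?.
    by apply: (@le_trans _ _ (1 + beta s 0)); [lra|rewrite ler_peMr; lra].
  by rewrite ler_peMr ?bz ?kappa1.
have b_kp : beta s t <= kappa s * phi t.
  apply: (le_trans (bpsi _ _ s0 t0)); rewrite ler_pM ?psi0 ?gkappa//.
    by rewrite (le_trans ler01)// g1.
  by apply: le_trans (pphi _ t0); have := inv0 _ t0; lra.
have bst := b0 _ _ s0 t0.
(* After squaring, the claim is the product of the bounds [b_ak] and [b_kp]. *)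
rewrite /A -(@ler_pXn2r _ 2) ?nnegrE ?mulr_ge0 ?sqrtr_ge0//.
rewrite !exprMn !sqr_sqrtr ?alpha0 ?(ltW (phi0 _ _))//.
rewrite (_ : _ * _ * _ = (alpha s * kappa s) * (kappa s * phi t)); last by ring.
by rewrite expr2 ler_pM.
Qed.

End KLMajorant.

(** * Stability *)

Lemma lty_le_real (R : realType) (e : \bar R) : (e < +oo)%E ->
  exists K : R, 0 <= K /\ (e <= K%:E)%E.
Proof.
case: e => [k _| |_] //; last by exists 0; rewrite leNye.
by exists `|k|; rewrite lee_fin ler_norm.
Qed.

Lemma classK_small (R : realType) (g : R -> R) (eps : R) : classK g -> 0 < eps ->
  exists delta : R, 0 < delta /\ g delta < eps.
Proof.
move=> [_ /subspace_continuousP/(_ 0 (lexx _)) gc g0 _] eps0.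
have /cvgrPdist_lt/(_ _ eps0) := gc.
move=> /nbhs_ballP[d /= d0 dg]; exists (d / 2); split; first lra.
have : ball 0 d (d / 2) -> 0 <= d / 2 -> `|g 0 - g (d / 2)| < eps by exact: dg.
rewrite g0 sub0r normrN /= => gd.
apply: le_lt_trans (ler_norm _) (gd _ _); last lra.
by rewrite /ball/= sub0r normrN gtr0_norm; lra.
Qed.

Section Stability.
Context {R : realType} {n m1 m2 : nat} {r : R}.
Context {D : set 'rV[R]_m1} {U : set 'rV[R]_m2}.
Context {f : (R -> 'rV[R]_n) -> (R -> 'rV[R]_m1) -> (R -> 'rV[R]_m2) -> 'rV[R]_n}.
Implicit Types (x y : R -> 'rV[R]_n) (d : R -> 'rV[R]_m1) (u : R -> 'rV[R]_m2).

Lemma inorm_ge0 u t : 0 <= inorm r u t.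
Proof. exact: supn_ge0. Qed.

Lemma inorm_le u s t : Usp r U u -> 0 <= s -> s <= t ->
  inorm r u s <= supn (itv_cc (- r) t) u.
Proof.
move=> Lu s0 st; apply: supn_le; first exact: supn_ge0.
apply: ae_on_shift (ae_le_supn (Lu t)) => s' /andP[? ?].
by apply/andP; split; lra.
Qed.

(** The essential bound of [u] on [[-r, t]] dominates every window norm up to time [t]. Finiteness
    lets the extended-real differences in [dev_set] be handled as real ones. *)
Lemma gain_sup_fin gamma u t : gain_fun gamma -> Usp r U u -> 0 <= t ->
  exists g : R, 0 <= g /\ gain_sup r gamma u t = g%:E.
Proof.
move=> [g0 _ gmono] Lu t0.
have ge0 : (0 <= gain_sup r gamma u t)%E.
  apply: (@le_trans _ _ (gamma (inorm r u 0))%:E).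
    by rewrite lee_fin g0// inorm_ge0.
  by apply: ereal_sup_ubound; exists 0 => //; apply/andP.
have le : (gain_sup r gamma u t <= (gamma (supn (itv_cc (- r) t) u))%:E)%E.
  apply: ge_ereal_sup => _ [s /andP[s0 st] <-].
  by rewrite lee_fin gmono ?inorm_ge0//; exact: inorm_le.
exists (fine (gain_sup r gamma u t)); rewrite fine_ge0//; split => //.
by rewrite fineK// fin_real// (lt_le_trans _ ge0) ?ltNy0//= (le_lt_trans le) ?ltry.
Qed.

Lemma dev_set_sub gamma (A B : set R) (a b : R) : A `<=` B -> a <= b ->
  dev_set r D U f gamma A a `<=` dev_set r D U f gamma B b.
Proof.
move=> AB ab e [x0 [d [u [x [t [L S At xa ->]]]]]].
by exists x0, d, u, x, t; split => //; [exact: AB|exact: le_trans ab].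
Qed.

Lemma KL_estimate_ISS : 0 < r -> H1 r D U f -> KL_estimate r D U f -> ISS r D U f.
Proof.
move=> r0 Hf [sigma [gamma [[_ sK santi svan] gainf est]]].
(* One bound yields all three properties: [tau = 0] for Lagrange and Lyapunov stability, large [tau]
   for attractivity. *)
have dev_le (a tau : R) : 0 <= a -> 0 <= tau ->
    (ereal_sup (dev_set r D U f gamma (Defs.itv_ge tau) a) <= (sigma a tau)%:E)%E.
  move=> a0 tau0; apply: ge_ereal_sup => _ [x0 [d [u [x [t [[L0 Ld Lu] S taut xa ->]]]]]].
  have t0 : 0 <= t by exact: le_trans taut.
  have [g [g0 gE]] := gain_sup_fin gainf Lu t0.
  have [x' [S' /(_ t t0)]] := est x0 d u L0 Ld Lu.
  rewrite gE -EFinD -EFinB !lee_fin => xt.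
  (* The estimate concerns some solution [x'], whereas [dev_set] ranges over all of them; uniqueness
     carries it over to [x]. *)
  have xx' := hnorm_unique r0 Hf Ld Lu S S' t0.
  have sa : sigma (hnorm r x0 0) t <= sigma a t.
    have [_ _ _ smono] := sK t t0; move: xa; rewrite le_eqVlt => /predU1P[->//|xa].
    by apply/ltW/smono => //; exact: supn_ge0.
  have := santi a tau t a0 tau0 taut; lra.
split; first by move=> x0 d u L0 Ld Lu; have [x [S _]] := est x0 d u L0 Ld Lu; exists x.
exists gamma; split => //.
- by move=> eps eps0; apply: le_lt_trans (dev_le _ _ (ltW eps0) (lexx _)) (ltry _).
- move=> eps eps0; have [delta [delta0 sd]] := classK_small (sK 0 (lexx _)) eps0.
  exists delta; split => //.
  by apply: le_lt_trans (dev_le _ _ (ltW delta0) (lexx _)) _; rewrite lte_fin.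
- move=> eps a eps0 a0; have /cvgrPdist_lt/(_ _ eps0) := svan a a0 => sev.
  have [tau tau0 /= stau] := pinfty_ex_gt0 sev; exists tau; split => //.
  apply: le_lt_trans (dev_le _ _ a0 (ltW tau0)) _; rewrite lte_fin.
  by move: stau; rewrite sub0r normrN; apply: le_lt_trans; exact: ler_norm.
Qed.

Lemma ISS_KL_estimate : ISS r D U f -> KL_estimate r D U f.
Proof.
move=> [fc [gamma [gainf lag lya ura]]].
pose dev (s t : R) := ereal_sup (dev_set r D U f gamma (Defs.itv_ge t) s).
(* The maximum with [0] excludes [-oo] and negative values, which the subtracted gain can
   produce. *)
pose beta (s t : R) : R := fine (Order.max 0%E (dev s t)).
have ge_sub (t t' : R) : t <= t' -> Defs.itv_ge t' `<=` Defs.itv_ge t.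
  by move=> tt' z; exact: le_trans.
have dev_mono (s s' t t' : R) : s <= s' -> t <= t' -> (dev s t' <= dev s' t)%E.
  by move=> ss' tt'; apply: ereal_sup_le; apply: dev_set_sub => //; exact: ge_sub.
have betaE (s t : R) : 0 <= s -> 0 <= t -> Order.max 0%E (dev s t) = (beta s t)%:E.
  move=> s0 t0; rewrite fineK// fin_real//; apply/andP; split.
    by rewrite lt_max ltNy0.
  (* Lagrange stability is stated for positive radii; [s + 1] covers [s = 0]. *)
  rewrite gt_max ltry/=; apply: le_lt_trans (lag (s + 1) _); last lra.
  by apply: dev_mono => //; lra.
have beta_le (s t eps : R) : 0 <= s -> 0 <= t -> 0 <= eps -> (dev s t <= eps%:E)%E ->
    beta s t <= eps.
  by move=> s0 t0 eps0 de; rewrite -lee_fin -betaE// ge_max lee_fin eps0.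
have beta_mono (s s' t t' : R) : 0 <= s -> s <= s' -> 0 <= t -> t <= t' ->
    beta s t' <= beta s' t.
  move=> s0 ss' t0 tt'; have t'0 := le_trans t0 tt'; have s'0 := le_trans s0 ss'.
  rewrite -lee_fin -!betaE// ge_max !le_max lexx/=.
  by rewrite dev_mono ?orbT.
have [|||||sigma [sKL bs]] := @KL_majorant R beta.
- by move=> s t s0 t0; rewrite -lee_fin -betaE// le_max lexx.
- by move=> s s' t s0 ss' t0; exact: beta_mono.
- by move=> s t t' s0 t0 tt'; exact: beta_mono.
- move=> eps eps0; have [delta [delta0 /ltW dd]] := lya eps eps0.
  by exists delta; split => //; apply: beta_le => //; exact: ltW.
- move=> eps s eps0 s0; have [tau [tau0 /ltW dd]] := ura eps s eps0 s0.
  by exists tau; split; [|apply: beta_le => //]; exact: ltW.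
exists sigma, gamma; split => // x0 d u L0 Ld Lu.
have [x S] := fc x0 d u L0 Ld Lu; exists x; split => // t t0.
have [g [g0 gE]] := gain_sup_fin gainf Lu t0.
rewrite gE -EFinD lee_fin; have := bs (hnorm r x0 0) t (supn_ge0 _ _) t0.
have : hnorm r x t - g <= beta (hnorm r x0 0) t; last lra.
rewrite -lee_fin -betaE//; last exact: supn_ge0.
rewrite le_max; apply/orP; right; apply: ereal_sup_ubound.
by exists x0, d, u, x, t; split => //; [exact: lexx|rewrite gE EFinB].
Qed.

End Stability.

(** * Systems with [U = {0}] *)

Section ZeroInput.
Context {R : realType} {n m1 m2 : nat} {r : R}.
Context {D : set 'rV[R]_m1}.
Context {f : (R -> 'rV[R]_n) -> (R -> 'rV[R]_m1) -> (R -> 'rV[R]_m2) -> 'rV[R]_n}.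
Implicit Types (x y : R -> 'rV[R]_n) (d : R -> 'rV[R]_m1) (u : R -> 'rV[R]_m2).
Let U0 : set 'rV[R]_m2 := [set 0].

Lemma Linf_cst0 k (A : set R) (V : set 'rV[R]_k) : V 0 -> Linf A V (fun=> 0).
Proof.
move=> V0; split; first by move=> i; exact: measurable_cst.
  by apply: (@esssup_lty _ _ _ 0); apply: ae_onW => s _; rewrite vnorm0.
exact: ae_onW.
Qed.

Lemma Usp_cst0 : Usp r U0 (fun=> 0).
Proof.
by move=> T; exact: Linf_cst0.
Qed.

Lemma inorm_zero u t : Usp r U0 u -> 0 <= t -> inorm r u t = 0.
Proof.
move=> /Usp_shift Lu t0; apply/le_anti; rewrite inorm_ge0 andbT.
have [_ _ u0] := Lu _ t0; apply: supn_le => //.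
by apply: ae_on_sub u0 => // s _ ->; rewrite vnorm0.
Qed.

Lemma gain_sup_zero gamma u t : Usp r U0 u -> 0 <= t ->
  gain_sup r gamma u t = (gamma 0)%:E.
Proof.
move=> Lu t0; apply/le_anti/andP; split.
  apply: ge_ereal_sup => _ [s /andP[s0 _] <-].
  by rewrite (inorm_zero Lu s0).
apply: ereal_sup_ubound; exists 0; first by apply/andP.
by rewrite (inorm_zero Lu (lexx _)).
Qed.

(** An input with values in [{0}] vanishes only almost everywhere, while [RFC] speaks of the
    constant function [0]; invariance of [f] under almost everywhere equality bridges the gap. *)
Lemma global_solution_zero x0 d u x : f_welldef r D U0 f -> Dsp r D d -> Usp r U0 u ->
  global_solution r f x0 d u x -> global_solution r f x0 d (fun=> 0) x.
Proof.
move=> wf Ld Lu [Lx ix xS]; split => //.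
apply: ae_on_sub xS => // t t0 ->.
apply: wf; try exact: ae_onW.
- exact: shift_X0sp (Lx t) t0 (lexx _).
- exact: shift_X0sp (Lx t) t0 (lexx _).
- exact: Dsp_shift.
- exact: Dsp_shift.
- exact: Usp_shift.
- exact: Usp_shift Usp_cst0 t0.
- by have [_ _] := Usp_shift Lu t0.
Qed.

Lemma ISS_RFC_URA : ISS r D U0 f -> RFC_URA r D U0 f.
Proof.
move=> [fc [gamma [gainf lag _ ura]]]; split; last by exists gamma.
split => // T a T0 a0.
have a1 : 0 < a + 1 by lra.
have [L [L0 dL]] := lty_le_real (lag (a + 1) a1).
(* For the zero input the subtracted gain is the constant [gamma 0]. *)
apply: (@le_lt_trans _ _ (L + gamma 0)%:E); last exact: ltry.
apply: ge_ereal_sup => _ [x0 [d [x [t [[L0x Ld xa] S /andP[t0 tT] ->]]]]].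
rewrite lee_fin -lerBlDr -lee_fin EFinB.
apply: le_trans dL; apply: ereal_sup_ubound.
exists x0, d, (fun=> 0), x, t; split => //.
- by split => //; exact: Usp_cst0.
- lra.
- by rewrite gain_sup_zero//; exact: Usp_cst0.
Qed.

(** Finitely many windows of length [r] cover the interval. This turns bounds on the window norms of
    a solution into a pointwise bound. *)
Lemma ae_on_windows (T : R) (P : R -> Prop) : 0 < r -> 0 <= T ->
  (forall t, 0 <= t -> t <= T -> ae_on (itv_co (t - r) t) P) ->
  ae_on (itv_co (- r) T) P.
Proof.
move=> r0 T0 win.
suff H k (t : R) : t <= k%:R * r -> 0 <= t -> t <= T -> ae_on (itv_co (- r) t) P.
  apply: (H (Num.bound (T / r))) => //; rewrite -ler_pdivrMr//; apply/ltW.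
  by apply: le_lt_trans (archi_boundP _); rewrite ?divr_ge0// ltW.
elim: k t => [|k IH] t tk t0 tT.
  have -> : t = 0 by apply/le_anti; rewrite t0 andbT -(mul0r r).
  by rewrite -[- r]sub0r; exact: win.
have tr : t - r <= k%:R * r by move: tk; rewrite -natr1 mulrDl mul1r; lra.
(* The cut at [0] keeps the earlier endpoint within the range of the induction hypothesis. *)
pose t' := Num.max (t - r) 0.
have tt' : t - r <= t' by rewrite le_max lexx.
have t'0 : 0 <= t' by rewrite le_max lexx orbT.
have kr : 0 <= k%:R * r by rewrite mulr_ge0 ?ler0n// ltW.
apply: (@ae_onU _ (itv_co (- r) t') (itv_co (t - r) t)); last exact: win.
  move=> s /andP[? ?]; have [st'|t's] := ltP s t'; [left|right]; apply/andP => //.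
  by split => //; lra.
by apply: IH => //; rewrite ge_max ?tr//; apply/andP; split => //; lra.
Qed.

Lemma ae_on_hnorm_bound x (K T : R) : 0 < r -> 0 <= T ->
  (forall T, Linf (itv_co (- r) T) setT x) ->
  (forall t, 0 <= t -> t <= T -> hnorm r x t <= K) ->
  ae_on (itv_co (- r) T) (fun s => vnorm (x s) <= K).
Proof.
move=> r0 T0 Lx xK; apply: ae_on_windows => // t t0 tT.
have := ae_le_supn (shift_X0sp (Lx t) t0 (lexx _)).
move=> /(@ae_on_shift _ _ (itv_co (t - r) t) _ (- t)) xt.
apply: ae_on_sub (xt _) => //.
  move=> s _; rewrite /Defs.shift addrA subrr add0r => /le_trans; apply.
  exact: xK.
by move=> s /andP[? ?]; apply/andP; split; lra.
Qed.

Lemma zero_satisfies T d u : H3 r D U0 f -> Dsp r D d -> Usp r U0 u ->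
  satisfies f T (fun=> 0) d u.
Proof.
move=> [b [[[_ _ b0 _] _] fb]] Ld Lu; apply: ae_onW => t /andP[t0 _].
symmetry; apply: vnorm_le0.
have L0 : X0sp r (Defs.shift (fun=> 0 : 'rV[R]_n) t).
  exact: shift_X0sp (Linf_cst0 _ I) t0 (lexx _).
apply: le_trans (fb _ _ _ L0 (Dsp_shift Ld t0) (Usp_shift Lu t0)) _.
rewrite -[supn _ (Defs.shift u t)]/(inorm r u t) inorm_zero//.
rewrite (_ : supn _ _ = 0) ?maxxx ?b0//.
apply/le_anti; rewrite supn_ge0 andbT; apply: supn_le => //.
by apply: ae_onW => s _; rewrite /Defs.shift vnorm0.
Qed.

(* Over a finite horizon [0] is an equilibrium by (H3), and by (H1) solutions
   depend continuously on the initial state. *)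
Lemma small_on_bounded_time (T eps : R) : 0 < r -> compact D ->
  f_welldef r D U0 f -> H1 r D U0 f -> H3 r D U0 f -> RFC r D U0 f ->
  0 <= T -> 0 < eps ->
  exists delta : R, [/\ 0 < delta, delta <= 1 & forall x0 d u x t,
    X0sp r x0 -> Dsp r D d -> Usp r U0 u -> global_solution r f x0 d u x ->
    hnorm r x0 0 <= delta -> 0 <= t -> t <= T -> hnorm r x t <= eps].
Proof.
move=> r0 cD wf Hf Hb [_ rfc] T0 eps0.
have [K1 [K10 xK1]] := lty_le_real (rfc T 1 T0 ler01).
have [K2 [K20 dK2]] := compact_vnorm_bounded cD.
(* [K1] bounds the solutions starting in the unit ball, [K2] the disturbances in the compact set
   [D]; the [1] ensures positivity. *)
have K0 : 0 < K1 + K2 + 1 by lra.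
have [G [G0 HG]] := continuous_dependence r0 Hf K0 T0.
have Ge : 0 < eps / (G + 1) by rewrite divr_gt0//; lra.
(* The [1] keeps the initial state in the ball for which [K1] was chosen; [G + 1] avoids division by
   zero. *)
exists (Num.min 1 (eps / (G + 1))); split; rewrite ?lt_min ?ltr01 ?ge_min ?lexx//.
move=> x0 d u x t L0 Ld Lu S; rewrite le_min => /andP[x1 xe] t0 tT.
have [Lx ix _] := S.
have xK : ae_on (itv_co (- r) T) (fun s => vnorm (x s) <= K1).
  apply: ae_on_hnorm_bound => // t' t'0 t'T; rewrite -lee_fin.
  apply: le_trans xK1; apply: ereal_sup_ubound; exists x0, d, x, t'; split => //.
    exact: global_solution_zero S.
  by apply/andP.
have [_ _ dD] := Ld; have [_ _ u0] := Lu T.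
have := HG x (fun=> 0) d u (eps / (G + 1)) (ltW Ge) (Lx T) _ Ld Lu.
move=> /(_ (Linf_cst0 _ I)) H.
have {}H : ae_on (itv_co (- r) T) (fun s => vnorm (x s - 0) <= G * (eps / (G + 1))).
  apply: H.
  - by apply: ae_on_sub xK => // s _ ?; lra.
  - by apply: ae_onW => s _; rewrite vnorm0 ltW.
  - have dD' : ae_on (itv_cc (- r) T) (fun s => D (d s)).
      by apply: ae_on_sub dD => // s /andP[].
    apply: ae_on_sub (ae_on_and dD' u0) => // s _ [/dK2 ds us].
    apply: le_trans (wnorm_le ds (lexx _)) _.
    by rewrite us vnorm0; lra.
  - exact: global_satisfies S.
  - exact: zero_satisfies.
  - apply: ae_on_sub (ae_on_and ix (ae_le_supn L0)) => // s _ [-> xs].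
    rewrite subr0; apply: (le_trans xs); apply: le_trans xe.
    rewrite /hnorm (_ : Defs.shift x0 0 = x0)//.
    by apply/funext => s'; rewrite /Defs.shift add0r.
have Geps : G * (eps / (G + 1)) <= eps.
  rewrite mulrCA ler_piMr ?(ltW eps0)// ler_pdivrMr; lra.
apply: supn_le; first exact: ltW.
have tsub s : itv_co (- r) 0 s -> itv_co (- r) T (t + s).
  by move=> /andP[? ?]; apply/andP; split; lra.
apply: ae_on_sub (ae_on_shift tsub H) => // s _.
by rewrite subr0 => /le_trans; apply.
Qed.

(** The gain of the attractivity property serves throughout. Attractivity settles times after [tau];
    before [tau], forward completeness gives boundedness and [small_on_bounded_time] gives
    smallness. *)
Lemma RFC_URA_ISS : 0 < r -> compact D ->
  f_welldef r D U0 f -> H1 r D U0 f -> H3 r D U0 f ->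
  RFC_URA r D U0 f -> ISS r D U0 f.
Proof.
move=> r0 cD wf Hf Hb [rfc' [gamma [gainf ura]]]; have [fc rfc] := rfc'.
split => //; exists gamma; split => //.
- move=> eps eps0; have [tau [tau0 dtau]] := ura 1 eps ltr01 (ltW eps0).
  have [K [K0 xK]] := lty_le_real (rfc tau eps (ltW tau0) (ltW eps0)).
  apply: (@le_lt_trans _ _ (1 + K)%:E); last exact: ltry.
  apply: ge_ereal_sup => _ [x0 [d [u [x [t [[L0 Ld Lu] S t0 xa ->]]]]]].
  have g0 : 0 <= gamma 0 by case: gainf => g0 _ _; exact: g0.
  have [tt|tt] := leP tau t.
    apply: (@le_trans _ _ 1%:E); last by rewrite lee_fin; lra.
    apply: le_trans (ltW dtau); apply: ereal_sup_ubound.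
    by exists x0, d, u, x, t.
  rewrite gain_sup_zero// -EFinB lee_fin.
  suff : hnorm r x t <= K by lra.
  rewrite -lee_fin; apply: le_trans xK; apply: ereal_sup_ubound.
  exists x0, d, x, t; split => //; first exact: global_solution_zero S.
  by apply/andP; split => //; exact: ltW.
- move=> eps eps0; have e20 : 0 < eps / 2 by lra.
  (* Radius [1] suffices since [delta <= 1] below; halving [eps] makes the final bound on the
     supremum strict. *)
  have [tau [tau0 dtau]] := ura (eps / 2) 1 e20 ler01.
  have [delta [delta0 delta1 small]] :=
    small_on_bounded_time r0 cD wf Hf Hb rfc' (ltW tau0) e20.
  exists delta; split => //.
  apply: (@le_lt_trans _ _ (eps / 2)%:E); last by rewrite lte_fin; lra.
  apply: ge_ereal_sup => _ [x0 [d [u [x [t [[L0 Ld Lu] S t0 xa ->]]]]]].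
  have g0 : 0 <= gamma 0 by case: gainf => g0 _ _; exact: g0.
  have [tt|tt] := leP tau t.
    apply: le_trans (ltW dtau); apply: ereal_sup_ubound.
    by exists x0, d, u, x, t; split => //; exact: le_trans delta1.
  rewrite gain_sup_zero// -EFinB lee_fin.
  have := small x0 d u x t L0 Ld Lu S xa t0 (ltW tt); lra.
Qed.

End ZeroInput.

Theorem theorem2p4 (R : realType) (n m1 m2 : nat) (r : R)
  (D : set 'rV[R]_m1) (U : set 'rV[R]_m2)
  (f : (R -> 'rV[R]_n) -> (R -> 'rV[R]_m1) -> (R -> 'rV[R]_m2) -> 'rV[R]_n) :
  (0 < n)%N -> (0 < m1)%N -> (0 < m2)%N -> 0 < r ->
  compact D -> loc_compact_set U -> U 0 ->
  f_welldef r D U f -> H1 r D U f -> H2 r D U f -> H3 r D U f ->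
  (ISS r D U f <-> KL_estimate r D U f) /\
  (U = [set 0] -> (ISS r D U f <-> RFC_URA r D U f)).
Proof.
move=> _ _ _ r0 cD _ _ wf Hf _ Hb; split.
  by split; [exact: ISS_KL_estimate|exact: KL_estimate_ISS].
move=> U0; rewrite U0 in wf Hf Hb *.
by split; [exact: ISS_RFC_URA|exact: RFC_URA_ISS].
Qed.
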